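(* Denote by $K_k$ the clique (complete graph) of size $k$. For every $k\ge1$, the density of $K_k$ in the graphon $W^{(\mathrm{circle})}$ is $$\mathrm{Dens}(K_k,W^{(\mathrm{circle})})=\frac1{m_k}=\frac{2^k\,k!}{(2k)!},$$ where $m_k$ is the number of matchings of size $k$. In particular the density of edges $\mathrm{Dens}(K_2,W^{(\mathrm{circle})})$ equals $1/3$ and the density of triangles $\mathrm{Dens}(K_3,W^{(\mathrm{circle})})$ equals $1/15$.
   Context: A matching of size $k$ is a fixed-point free involution on $\{1,\dots,2k\}$. For reals $x_A,x_B,y_A,y_B\in[0,1]$, the pairs $(x_A,x_B)$ and $(y_A,y_B)$ are crossing if the four numbers are pairwise distinct and the chord of the unit circle joining $e^{2\mathbf i\pi x_A}$ and $e^{2\mathbf i\pi x_B}$ intersects the chord joining $e^{2\mathbf i\pi y_A}$ and $e^{2\mathbf i\pi y_B}$. Let $\Psi=(\Psi_A,\Psi_B):[0,1]\to[0,1]^2$ be any measurable function pushing Lebesgue measure on $[0,1]$ to Lebesgue measure on $[0,1]^2$. $W^{(\mathrm{circle})}$ is the graphon represented by $w(x,y)=\mathbb 1[(\Psi_A(x),\Psi_B(x))\text{ and }(\Psi_A(y),\Psi_B(y))\text{ are crossing}]$ (graphons being symmetric measurable functions $[0,1]^2\to[0,1]$ with functions at cut distance $0$ identified; the graphon does not depend on the choice of $\Psi$). For a graphon $W$ with representative $w$, $\mathrm{Sample}_k(W)$ is the unlabeled random graph with $k$ vertices $v_1,\dots,v_k$ obtained by taking $X_1,\dots,X_k$ i.i.d.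 uniform in $[0,1]$ and connecting $v_i$ and $v_j$ with probability $w(X_i,X_j)$ (independently for distinct pairs conditionally on $(X_1,\dots,X_k)$). For a graph $g$ with $k$ vertices, $\mathrm{Dens}(g,W)=\mathbb P(\mathrm{Sample}_k(W)=g)$. *)

(* Defs.v *)
From HB Require Import structures.
From mathcomp Require Import all_boot all_order all_algebra.
From mathcomp Require Import all_classical all_reals all_analysis.
From mathcomp Require Import perm complex.
Import Order.TTheory GRing.Theory Num.Theory.
Import numFieldNormedType.Exports.

Set Implicit Arguments.
Unset Strict Implicit.
Unset Printing Implicit Defensive.

Local Open Scope classical_set_scope.
Local Open Scope ring_scope.

(* The points {1, ..., 2k} are encoded as 'I_(2 * k). *)
Definition matchings (k : nat) : {set {ffun 'I_(2 * k) -> 'I_(2 * k)}} :=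
  [set s : {ffun 'I_(2 * k) -> 'I_(2 * k)} |
    [forall i, (s i != i) && (s (s i) == i)]]%SET.

Definition num_matchings (k : nat) : nat := #|matchings k|.

Record simple_graph (k : nat) := SimpleGraph {
  edge :> rel 'I_k ;
  edge_sym : symmetric edge ;
  edge_irr : irreflexive edge }.

Definition isomorphic (k : nat) (g h : simple_graph k) : Prop :=
  exists s : {perm 'I_k}, forall i j, h (s i) (s j) = g i j.

Lemma clique_sym k : symmetric (fun i j : 'I_k => i != j).
Proof. by move=> i j; rewrite eq_sym. Qed.

Lemma clique_irr k : irreflexive (fun i j : 'I_k => i != j).
Proof. by move=> i; rewrite eqxx. Qed.

Definition clique (k : nat) : simple_graph k :=
  SimpleGraph (@clique_sym k) (@clique_irr k).

(* The simple graph whose edges are the {i, j}, i < j, such that e i j;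
   the values e i j with i >= j are ignored. *)
Definition upper_edge (k : nat) (e : rel 'I_k) : rel 'I_k :=
  fun i j => ((i < j)%N && e i j) || ((j < i)%N && e j i).

Lemma upper_edge_sym k (e : rel 'I_k) : symmetric (upper_edge e).
Proof. by move=> i j; rewrite /upper_edge orbC. Qed.

Lemma upper_edge_irr k (e : rel 'I_k) : irreflexive (upper_edge e).
Proof. by move=> i; rewrite /upper_edge ltnn. Qed.

Definition upper_graph (k : nat) (e : rel 'I_k) : simple_graph k :=
  SimpleGraph (upper_edge_sym e) (upper_edge_irr e).

Section product_probability.
Context d (T : measurableType d) (R : realType) (P : probability T R).

Definition cons_tuple_pair n (x : T * n.-tuple T) : n.+1.-tuple T :=
  [tuple of x.1 :: x.2].

Lemma measurable_cons_tuple_pair n :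
  measurable_fun [set: T * n.-tuple T] (@cons_tuple_pair n).
Proof. by apply: measurable_cons. Qed.

HB.instance Definition _ n := isMeasurableFun.Build _ _ _ _
  (@cons_tuple_pair n) (@measurable_cons_tuple_pair n).

(* The law of n independent variables of law P. *)
Fixpoint iid_prob (n : nat) : probability (n.-tuple T) R :=
  match n with
  | 0 => \d_([tuple] : 0.-tuple T)
  | m.+1 => distribution (P \x iid_prob m)%E (@cons_tuple_pair m)
  end.

End product_probability.

Section graphon.
Context (R : realType).

Definition unif01 : probability (measurableTypeR R) R :=
  uniform_prob (@ltr01 R).

(* [Sample_k] is realised on the space of pairs (X, U), where the X_i and the
   U_ij are independent and uniform in [0, 1]: conditionally on X, the event
   U_ij < w (X_i, X_j) has probability w (X_i, X_j), independently for distinct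
   pairs i < j. *)
Definition sample_prob (k : nat) :
    probability (k.-tuple (measurableTypeR R) *
                 k.-tuple (k.-tuple (measurableTypeR R)))%type R :=
  (iid_prob unif01 k \x iid_prob (iid_prob unif01 k) k)%E.

Definition sample (k : nat) (w : R -> R -> R)
    (xu : k.-tuple (measurableTypeR R) *
          k.-tuple (k.-tuple (measurableTypeR R))) :
    simple_graph k :=
  upper_graph (fun i j =>
    tnth (tnth xu.2 i) j < w (tnth xu.1 i) (tnth xu.1 j)).

(* Graphs with k vertices are given up to isomorphism by their edge relation on
   'I_k.  The graphon is given by a representative w, of which only the values
   on [0, 1]^2 matter: the X_i are almost surely in [0, 1], and requiring it
   keeps the event measurable when w is only measurable on the unit square. *)
Definition Dens (k : nat) (g : simple_graph k) (w : R -> R -> R) : \bar R :=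
  sample_prob k [set xu | (forall i, tnth xu.1 i \in `[0, 1]%R) /\
                          isomorphic (sample w xu) g].

(* e^(2 i pi x) *)
Definition circle_point (x : R) : R[i] :=
  (cos (2 * pi * x) +i* sin (2 * pi * x))%C.

Definition chord (x y : R) : set R[i] :=
  [set z | exists2 t : R, t \in `[0, 1]%R &
     z = ((1 - t)%:C * circle_point x + t%:C * circle_point y)%C].

Definition crossing (x y : R * R) : Prop :=
  uniq [:: x.1; x.2; y.1; y.2] /\
  chord x.1 x.2 `&` chord y.1 y.2 !=set0.

Definition unit_interval : set (measurableTypeR R) := `[0%R, 1%R]%classic.

Definition pushes_to_unit_square
    (Psi : measurableTypeR R -> measurableTypeR R * measurableTypeR R) : Prop :=
  [/\ forall x, x \in `[0, 1]%R ->
        (Psi x).1 \in `[0, 1]%R /\ (Psi x).2 \in `[0, 1]%R,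
      measurable_fun unit_interval Psi &
      forall B, measurable B ->
        lebesgue_measure (unit_interval `&` Psi @^-1` B) =
        (lebesgue_measure \x lebesgue_measure)%E
          (B `&` (unit_interval `*` unit_interval))].

Definition circle_graphon
    (Psi : measurableTypeR R -> measurableTypeR R * measurableTypeR R) :
    R -> R -> R :=
  fun x y => (`[< crossing (Psi x) (Psi y) >])%:R.

End graphon.

(* Main.v *)
From HB Require Import structures.
Require Import Defs.
From mathcomp Require Import all_boot all_order all_algebra all_fingroup.
From mathcomp Require Import all_classical all_reals all_analysis.
From mathcomp Require Import measurable_realfun complex zify ring lra.
Import Order.TTheory GRing.Theory Num.Theory.

(** The vertices of the sampled graph are k chords whose 2k endpoints are
independent and uniform in [0, 1], and the graph is complete when these chords
cross pairwise. The density is found without computing any volume, by letting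
the pairing of the endpoints vary among all perfect matchings of the index set.

Exchangeability. For a perfect matching s of the indices, let E_s be the event
that any two pairs of s interlace. Any two perfect matchings are conjugate
under a permutation of the indices ([perfect_matchings_conj]), and the law of
an i.i.d. family is invariant under such a permutation ([iid_exchangeable]), so
P(E_s) is the same for all s.

Uniqueness. Almost surely the endpoints are pairwise distinct
([iid_injective]), and then exactly one E_s occurs
([exists_unique_crossing_matching]): if all the pairs of s interlace, then
strictly between the two ends of a pair lies one end of each of the k - 1 other
pairs, so s pairs each point with the one which is k ranks away. Hence the m_k
equal probabilities P(E_s) sum to 1 ([prob_crossing_matching]).

Geometry. Two chords of the circle meet exactly when the endpoints of each one
are on both sides of the line through the other, up to degenerate positions
([crossing_sides]). The position of a point of the circle with respect to such
a line is given by a product of three sines, which turns crossing into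
interlacing for parameters in ]0, 1[ ([on_both_sides_interlaced]). It also
shows that the crossing relation is measurable on the whole square, which gives
a meaning to the probability of a clique.

Counting. Choosing the partner of a point leaves a perfect matching of the
remaining points, so m_k = (2k - 1) m_(k-1) and m_k 2^k k! = (2k)!
([card_perfect_matchings]). *)

Set Implicit Arguments.
Unset Strict Implicit.
Unset Printing Implicit Defensive.

Local Open Scope ring_scope.

(** * Perfect matchings of a finite set *)

Section PerfectMatchings.
Local Open Scope set_scope.
Local Open Scope nat_scope.

Section Matchings.
Variable T : finType.
Implicit Types (A : {set T}) (s : {perm T}).

(** Fixed-point free involutions of [A], encoded as the permutations of [T] that
are trivial outside [A]: subsets of [T] then share one type, on which induction
on the cardinal of [A] is possible. *)
Definition perfect_matchings A : {set {perm T}} :=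
  [set s : {perm T} | [forall x, ((s x != x) == (x \in A)) && (s (s x) == x)]].

Lemma perfect_matchingsP A s :
  reflect ((forall x, (s x != x) = (x \in A)) /\ involutive s)
          (s \in perfect_matchings A).
Proof.
rewrite inE; apply: (iffP forallP) => [h|[h1 h2] x].
  by split=> x; have /andP[/eqP ? /eqP ?] := h x.
by rewrite h1 h2 !eqxx.
Qed.

(** Removing the pair {x, y} from a matching amounts to composing it with the
transposition of x and y. This is the bijection behind the recursion for the
number of matchings. *)
Lemma mul_tperm_perfect_matching A x y s : x != y -> x \in A -> y \in A ->
  (s * tperm x y \in perfect_matchings (A :\ x :\ y))%g =
  (s \in perfect_matchings A) && (s x == y).
Proof.
move=> nxy Ax Ay; apply/perfect_matchingsP/andP => [[hA hK]|[]].
  have sx : s x = y.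
    have := hA x; rewrite !inE eqxx andbF /= permM => /negbFE/eqP.
    by move/(congr1 (tperm x y)); rewrite tpermK tpermL.
  have sy : s y = x.
    have := hA y; rewrite !inE eqxx /= permM => /negbFE/eqP.
    by move/(congr1 (tperm x y)); rewrite tpermK tpermR.
  have sN z : z != x -> z != y -> (s * tperm x y)%g z = s z.
    move=> zx zy; rewrite permM tpermD //.
      by rewrite -sy (inj_eq perm_inj) eq_sym.
    by rewrite -sx (inj_eq perm_inj) eq_sym.
  split; last exact/eqP.
  apply/perfect_matchingsP; split=> z.
    have [->|zx] := eqVneq z x; first by rewrite sx eq_sym nxy Ax.
    have [->|zy] := eqVneq z y; first by rewrite sy nxy Ay.
    by rewrite -(sN z zx zy) hA !inE zx zy.
  have [->|zx] := eqVneq z x; first by rewrite sx sy.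
  have [->|zy] := eqVneq z y; first by rewrite sy sx.
  have := hK z; rewrite sN // sN //.
    by rewrite -sy (inj_eq perm_inj).
  by rewrite -sx (inj_eq perm_inj).
move=> /perfect_matchingsP[hA hK] /eqP sx.
have sy : s y = x by rewrite -sx hK.
have sN z : z != x -> z != y -> (s * tperm x y)%g z = s z.
  move=> zx zy; rewrite permM tpermD //.
    by rewrite -sy (inj_eq perm_inj) eq_sym.
  by rewrite -sx (inj_eq perm_inj) eq_sym.
split=> z.
  have [->|zx] := eqVneq z x; first by rewrite permM sx tpermR !inE eqxx andbF.
  have [->|zy] := eqVneq z y; first by rewrite permM sy tpermL !inE eqxx.
  by rewrite sN // !inE zx zy hA.
have [->|zx] := eqVneq z x; first by rewrite !permM sx tpermR sx tpermR.
have [->|zy] := eqVneq z y; first by rewrite !permM sy tpermL sy tpermL.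
rewrite sN // sN ?hK //.
  by rewrite -sy (inj_eq perm_inj).
by rewrite -sx (inj_eq perm_inj).
Qed.

(** Fix x in [A] and sort the matchings by the partner y of x: there are 2k + 1
values of y, and the matchings with given y correspond to those of
[A] minus {x, y}. *)
Lemma card_perfect_matchings k A : #|A| = k.*2 ->
  #|perfect_matchings A| * (2 ^ k * k`!) = (k.*2)`!.
Proof.
elim: k A => [|k IHk] A.
  move/eqP; rewrite cards_eq0 => /eqP ->.
  rewrite (_ : perfect_matchings finset.set0 = [set 1%g]%SET) ?cards1 //.
  apply/setP => s; rewrite finset.in_set1; apply/perfect_matchingsP/eqP => [[h _]|->].
    by apply/permP => x; rewrite perm1; apply/eqP/negbFE; rewrite h inE.
  by split=> x; rewrite !perm1 ?eqxx ?inE.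
move=> cA; have /card_gt0P[x Ax] : 0 < #|A| by rewrite cA.
have cAx : #|A :\ x| = k.*2.+1.
  by move: (cardsD1 x A); rewrite Ax cA doubleS add1n => -[].
have fibre y : y \in A :\ x ->
    #|[set s in perfect_matchings A | s x == y]| * (2 ^ k * k`!) = (k.*2)`!.
  rewrite !inE => /andP[yx Ay].
  rewrite -(IHk (A :\ x :\ y)); last first.
    by move: (cardsD1 y (A :\ x)); rewrite !inE yx Ay cAx add1n => -[].
  congr (_ * _); rewrite -(card_imset _ (mulIg (tperm x y))).
  congr #|pred_of_set _|; apply/setP => s.
  rewrite -[s in RHS](mulgKV (tperm x y)) tpermV.
  have xy : x != y by rewrite eq_sym.
  rewrite (mul_tperm_perfect_matching (s * tperm x y)%g xy Ax Ay).
  apply/imsetP/idP => [[u]|h].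
    by rewrite finset.in_set => h ->; rewrite -mulgA tperm2 mulg1.
  exists (s * tperm x y)%g; first by rewrite finset.in_set.
  by rewrite -mulgA tperm2 mulg1.
have -> : #|perfect_matchings A| =
    \sum_(y in A :\ x) #|[set s in perfect_matchings A | s x == y]|.
  rewrite -sum1_card (partition_big (fun s : {perm T} => s x) (mem (A :\ x))) /=.
    by apply: eq_bigr => y _; rewrite -sum1_card; apply: eq_bigl => s; rewrite inE.
  move=> s /perfect_matchingsP[hA hK].
  by rewrite !inE hA Ax -hA hK eq_sym hA Ax.
have -> : 2 ^ k.+1 * k.+1`! = 2 ^ k * k`! * k.+1.*2.
  by rewrite expnS factS -muln2; ring.
rewrite mulnA big_distrl /= (eq_bigr _ fibre) sum_nat_const cAx.
by rewrite doubleS !factS; ring.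
Qed.

End Matchings.

Lemma perfect_matching_setT (T : finType) (s : {perm T}) :
  s \in perfect_matchings [set: T] -> (forall x, s x != x) /\ involutive s.
Proof.
by move=> /perfect_matchingsP[h sK]; split=> // x; rewrite h inE.
Qed.

(** Choosing in each pair the point of least [enum_rank] labels the pairs by
['I_k] and the two ends of each pair by [bool]. All matchings thus look like
the pairing of (i, false) with (i, true), and are conjugate to one another. *)
Lemma matching_parametrization (T : finType) k (s : {perm T}) :
  #|T| = k.*2 -> s \in perfect_matchings [set: T] ->
  exists2 f : 'I_k * bool -> T,
    injective f & forall x, f (x.1, ~~ x.2) = s (f x).
Proof.
move=> cT /perfect_matching_setT[sN sK].
pose H := [set x : T | enum_rank x < enum_rank (s x)].
have sH x : (s x \in H) = (x \notin H).
  rewrite !inE sK -leqNgt ltn_neqAle.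
  by rewrite (inj_eq val_inj) (inj_eq enum_rank_inj) sN.
have cH : #|H| = k.
  apply: double_inj; rewrite -cT -addnn -(cardsC H); congr (_ + _).
  rewrite -(card_imset _ (@perm_inj _ s)); congr #|pred_of_set _|.
  apply/setP => x; rewrite inE; apply/imsetP/idP => [[y yH ->]|xH].
    by rewrite sH negbK.
  by exists (s x); rewrite ?sH ?sK.
pose e (i : 'I_k) : T := enum_val (cast_ord (esym cH) i).
have eH i : e i \in H by exact: enum_valP.
exists (fun x => if x.2 then s (e x.1) else e x.1); last first.
  by move=> [i []] //=; rewrite sK.
have e_inj : injective e by move=> i j /enum_val_inj/cast_ord_inj.
move=> [i [] ] [j []] /=.
- by move=> /perm_inj/e_inj ->.
- by move=> h; have := eH j; rewrite -h sH eH.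
- by move=> h; have := eH i; rewrite h sH eH.
- by move=> /e_inj ->.
Qed.

Lemma num_matchingsE k :
  num_matchings k = #|perfect_matchings [set: 'I_(2 * k)]|.
Proof.
rewrite /num_matchings.
pose F (s : {perm 'I_(2 * k)}) : {ffun 'I_(2 * k) -> 'I_(2 * k)} := [ffun x => s x].
have F_inj : injective F.
  by move=> s t /ffunP h; apply/permP => x; have := h x; rewrite !ffunE.
rewrite -(card_imset _ F_inj); congr #|pred_of_set _|; apply/setP => u.
apply/idP/imsetP => [|[s /perfect_matching_setT[sN sK] ->]].
  rewrite finset.in_set => /forallP h.
  have uN x : u x != x by have /andP[] := h x.
  have uK : involutive u by move=> x; have /andP[_ /eqP] := h x.
  exists (perm (inv_inj uK)); last by apply/ffunP => x; rewrite ffunE permE.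
  apply/perfect_matchingsP; split=> x; first by rewrite permE uN inE.
  by rewrite !permE uK.
by rewrite finset.in_set; apply/forallP => x; rewrite !ffunE sN sK eqxx.
Qed.

Lemma num_matchings_factorial k :
  num_matchings k * (2 ^ k * k`!) = (2 * k)`!.
Proof.
by rewrite num_matchingsE mul2n (@card_perfect_matchings _ k) // cardsT card_ord.
Qed.

Lemma card_perfect_matchings_setT (T : finType) k :
  #|T| = k.*2 -> #|perfect_matchings [set: T]| = num_matchings k.
Proof.
move=> cT; have c_gt0 : 0 < 2 ^ k * k`! by rewrite muln_gt0 expn_gt0 fact_gt0.
apply/eqP; rewrite -(eqn_pmul2r c_gt0) num_matchings_factorial.
by rewrite card_perfect_matchings ?cardsT // mul2n.
Qed.

Lemma perfect_matchings_conj (T : finType) k (s t : {perm T}) :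
  #|T| = k.*2 -> s \in perfect_matchings [set: T] -> t \in perfect_matchings [set: T] ->
  exists p : {perm T}, forall x, p (s x) = t (p x).
Proof.
move=> cT sM tM; have [f f_inj fs] := matching_parametrization cT sM.
have [g g_inj gt] := matching_parametrization cT tM.
have cK : #|T| <= #|{: 'I_k * bool}|.
  by rewrite card_prod card_ord card_bool cT muln2.
have [f' fK f'K] := inj_card_bij f_inj cK.
have p_inj : injective (g \o f') by exact: inj_comp g_inj (can_inj f'K).
exists (perm p_inj) => x; rewrite !permE /= -gt -[in LHS](f'K x) -fs fK.
by congr g.
Qed.
End PerfectMatchings.

(** * The matching that crosses itself everywhere *)

Section CrossingUniqueness.
Local Open Scope set_scope.
Local Open Scope order_scope.

(** For distinct points, [(a < c) (+) (b < c)] says that c lies between a and b;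
interlacing means that this holds for exactly one of c and e. Written as one
exclusive or, the relation is visibly symmetric under exchanging a and b, or c
and e. *)
Definition interlaced d (R : orderType d) (a b c e : R) : bool :=
  (a < c) (+) (b < c) (+) (a < e) (+) (b < e).

Section Interlaced.
Variables (d : Order.disp_t) (R : orderType d) (I : finType).
Implicit Types (z : I -> R) (s : {perm I}).

Definition crossing_matching z s : bool :=
  [forall i, forall j, (j != i) && (j != s i) ==>
     interlaced (z i) (z (s i)) (z j) (z (s j))].

Definition rank z (i : I) : nat := #|[set j | z j < z i]|.

Variables (z : I -> R) (z_inj : injective z).

Lemma rank_mono i j : (rank z i < rank z j)%N = (z i < z j).
Proof.
have sub a b : z a < z b -> (rank z a < rank z b)%N.
  move=> ab; apply: proper_card; apply/fintype.properP; split.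
    by apply/fintype.subsetP => c; rewrite !inE => /lt_trans; apply.
  by exists a; rewrite !inE ?ltxx.
apply/idP/idP => [|/sub//]; apply: contraLR; rewrite -leNgt -leqNgt.
by rewrite le_eqVlt => /orP[/eqP/z_inj ->//|/sub/ltnW].
Qed.

Lemma rank_inj : injective (rank z).
Proof.
move=> i j h; apply: z_inj; apply/eqP; apply/negPn/negP; rewrite neq_lt.
by rewrite -!rank_mono h ltnn.
Qed.

Lemma rank_lt i : (rank z i < #|I|)%N.
Proof.
rewrite -cardsT; apply: proper_card; apply/fintype.properP; split=> //.
by exists i; rewrite !inE ?ltxx.
Qed.

Lemma rank_surj k : (k < #|I|)%N -> exists i, rank z i = k.
Proof.
move=> kI; pose f i := Ordinal (rank_lt i).
have f_inj : injective f by move=> i j [] /rank_inj.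
have /codomP[i [->]] : Ordinal kI \in codom f.
  by rewrite inj_card_onto // card_ord.
by exists i.
Qed.

Variable k : nat.
Hypothesis cI : #|I| = k.*2.

Lemma rank_lt_double i : (rank z i < k.*2)%N.
Proof. by rewrite -cI rank_lt. Qed.

(** Ranks k apart, that is, antipodal points among 2k points on a circle. *)
Definition opposite_ranks s := forall i,
  rank z (s i) = (if (rank z i < k)%N then rank z i + k else rank z i - k)%N.

Lemma interlaced_rank i j a b : interlaced (z i) (z j) (z a) (z b) =
  interlaced (rank z i) (rank z j) (rank z a) (rank z b).
Proof. by rewrite /interlaced -!rank_mono. Qed.

(** The set S of points strictly between i and [s i] contains exactly one end of
each other pair. So S and its image under [s] partition the complement of
{i, s i}, S has k - 1 elements, and the rank grows by k from i to [s i]. *)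
Lemma crossing_matching_shift_lt s i :
  s \in perfect_matchings [set: I] -> crossing_matching z s ->
  (rank z i < rank z (s i))%N -> rank z (s i) = (rank z i + k)%N.
Proof.
move=> /perfect_matching_setT[sN sK] /forallP cs isi.
pose S := [set j | (rank z i < rank z j < rank z (s i))%N].
have cross j : j != i -> j != s i -> (s j \in S) = (j \notin S).
  move=> ji jsi; have /forallP/(_ j) := cs i; rewrite ji jsi /= interlaced_rank.
  have := ji; have := jsi; rewrite -!(inj_eq rank_inj).
  have : s j != i by rewrite -(inj_eq (@perm_inj _ s)) sK.
  have : s j != s i by rewrite (inj_eq (@perm_inj _ s)).
  rewrite -!(inj_eq rank_inj) !inE /interlaced !ltEnat /=.
  by move: isi; lia.
have iS : i \notin S by rewrite inE ltnn.
have siS : s i \notin S by rewrite inE ltnn andbF.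
have imS : s @: S = ~: (i |: (s i |: S)).
  apply/setP => j; rewrite -{1}[j]sK mem_imset; last exact: perm_inj.
  rewrite finset.in_setC !finset.in_setU1.
  have [->|ji] := eqVneq j i; first by rewrite (negPf siS).
  have [->|jsi] := eqVneq j (s i); first by rewrite sK (negPf iS).
  by rewrite cross.
have cS : (#|S| + #|S| + 2 = k.*2)%N.
  rewrite -[X in (X + _ + _)%N](card_imset _ (@perm_inj _ s)) imS -cI.
  rewrite -(cardsC (i |: (s i |: S))) !cardsU1 finset.in_setU1 (negPf iS) (negPf siS).
  by rewrite eq_sym (negPf (sN i)) /=; lia.
have : rank z (s i) = (rank z i + (1 + #|S|))%N.
  rewrite /rank -[X in (_ + X)%N]/(true + #|S|)%N -[true]iS -cardsU1 -cardsUI.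
  rewrite -[LHS]addn0; congr (_ + _)%N; last first.
    apply/esym/eqP; rewrite cards_eq0 -finset.subset0; apply/fintype.subsetP => j.
    rewrite !inE -rank_mono => /andP[h].
    by rewrite -(inj_eq rank_inj); lia.
  apply: eq_card => j; rewrite !inE -!rank_mono.
  by rewrite -(inj_eq rank_inj); lia.
lia.
Qed.

Lemma crossing_matching_opposite s :
  s \in perfect_matchings [set: I] -> crossing_matching z s -> opposite_ranks s.
Proof.
move=> sM cs i; have [sN sK] := perfect_matching_setT sM.
have lt := crossing_matching_shift_lt sM cs.
have := sN i; rewrite -(inj_eq rank_inj); have := rank_lt_double i.
have := rank_lt_double (s i); have := lt i; have := lt (s i); rewrite sK.
by case: ifP; lia.
Qed.

Lemma opposite_crossing_matching s :
  opposite_ranks s -> crossing_matching z s.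
Proof.
move=> opp; apply/forallP => i; apply/forallP => j; apply/implyP => /andP[].
rewrite interlaced_rank -!(inj_eq rank_inj) !opp.
rewrite /interlaced !ltEnat /=; have := rank_lt_double i; have := rank_lt_double j.
by case: ifP; case: ifP; lia.
Qed.

Lemma opposite_perfect_matching s :
  opposite_ranks s -> s \in perfect_matchings [set: I].
Proof.
move=> opp; apply/perfect_matchingsP; split=> i; last first.
  by apply: rank_inj; rewrite !opp; have := rank_lt_double i; do 2?case: ifP; lia.
rewrite inE -(inj_eq rank_inj) opp; have := rank_lt_double i; case: ifP; lia.
Qed.

Lemma opposite_ranks_exists : exists s, opposite_ranks s.
Proof.
have ex i : exists j, rank z j ==
    (if (rank z i < k)%N then rank z i + k else rank z i - k)%N.
  have [|j <-] := @rank_surj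
    (if (rank z i < k)%N then rank z i + k else rank z i - k)%N; last by exists j.
  by rewrite cI; have := rank_lt_double i; case: ifP; lia.
pose f i := xchoose (ex i).
have fE i : rank z (f i) = (if (rank z i < k)%N then rank z i + k else rank z i - k)%N.
  exact/eqP/(xchooseP (ex i)).
have f_inj : injective f.
  move=> i j fij; apply: rank_inj.
  have := rank_lt_double i; have := rank_lt_double j; have := congr1 (rank z) fij.
  by rewrite !fE; do 2?case: ifP; lia.
by exists (perm f_inj) => i; rewrite permE fE.
Qed.

(** Interlacing of all pairs forces the ranks, hence the matching; conversely
pairing opposite ranks makes all pairs interlace. *)
Lemma exists_unique_crossing_matching : exists s0, forall s,
  (s \in perfect_matchings [set: I]) && crossing_matching z s = (s == s0).
Proof.
have [s0 opp0] := opposite_ranks_exists; exists s0 => s.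
apply/andP/eqP => [[sM cs]|->].
  apply/permP => i; apply: rank_inj.
  by rewrite opp0 (crossing_matching_opposite sM cs).
by split; [exact: opposite_perfect_matching|exact: opposite_crossing_matching].
Qed.
End Interlaced.
End CrossingUniqueness.

(** * Crossing chords of the unit circle *)

Section Geometry.
Variable R : realType.
Implicit Types (a b c e t : R) (x y : R * R).

(** Twice the signed area of the triangle whose vertices are the points of the
circle with parameters a, b and c: its sign tells on which side of the line
through a and b the point c lies. *)
Definition side a b c : R :=
  4 * sin (pi * (b - a)) * sin (pi * (c - a)) * sin (pi * (c - b)).

Let u a : R := cos (2 * pi * a).
Let v a : R := sin (2 * pi * a).

(** The three factors come from the sum-to-product formulas: the difference of
two points of the circle is a unit vector times twice the sine of half of their
angle. *)
Lemma side_cross_product a b c :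
  side a b c = (u b - u a) * (v c - v a) - (v b - v a) * (u c - u a).
Proof.
have cosE p q : u q - u p = - 2 * sin (pi * (p + q)) * sin (pi * (q - p)).
  rewrite /u (_ : 2 * pi * q = pi * (p + q) + pi * (q - p)); last by ring.
  rewrite (_ : 2 * pi * p = pi * (p + q) - pi * (q - p)); last by ring.
  by rewrite cosD cosB; ring.
have sinE p q : v q - v p = 2 * cos (pi * (p + q)) * sin (pi * (q - p)).
  rewrite /v (_ : 2 * pi * q = pi * (p + q) + pi * (q - p)); last by ring.
  rewrite (_ : 2 * pi * p = pi * (p + q) - pi * (q - p)); last by ring.
  by rewrite sinD sinB; ring.
rewrite !cosE !sinE /side (_ : pi * (c - b) = pi * (a + c) - pi * (a + b)).
  by rewrite sinB; ring.
by ring.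
Qed.

Lemma chordP (z : R[i]) a b : chord a b z <->
  exists2 t, 0 <= t <= 1 &
    z = (((1 - t) * u a + t * u b) +i* ((1 - t) * v a + t * v b))%C.
Proof.
by split=> -[t t01 ->]; exists t; rewrite ?in_itv //= in t01 *;
  rewrite /circle_point; simpc.
Qed.

Definition on_both_sides a b c e : bool := side a b c * side a b e <= 0.

(** [side a b] extends to an affine function on the plane which vanishes on the
chord from a to b. It cannot have the same strict sign at c and e if it
vanishes at a point of the segment joining them. *)
Lemma chord_meet_on_both_sides a b c e :
  (chord a b `&` chord c e !=set0)%classic -> on_both_sides a b c e.
Proof.
move=> [z [/chordP[t t01 ->] /chordP[t' /andP[t'0 t'1] []]]] hu hv.
have zero : (1 - t') * side a b c + t' * side a b e = 0.
  rewrite !side_cross_product.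
  transitivity ((u b - u a) * (((1 - t') * v c + t' * v e) - v a)
    - (v b - v a) * (((1 - t') * u c + t' * u e) - u a)); first by ring.
  by rewrite -hu -hv; ring.
rewrite /on_both_sides leNgt; apply/negP => pos.
have : 0 < ((1 - t') * side a b c + t' * side a b e) * side a b c
   + ((1 - t') * side a b c + t' * side a b e) * side a b e.
  nra.
by rewrite zero !mul0r addr0 ltxx.
Qed.

Lemma sin_pi_lt0 a : -1 < a < 1 -> (sin (pi * a) < 0) = (a < 0).
Proof.
have pi0 := pi_gt0 R.
have pos b : 0 < b < 1 -> 0 < sin (pi * b).
  by move=> /andP[b0 b1]; apply: sin_gt0_pi; apply/andP; split; nra.
move=> /andP[a1 a2]; case: (ltgtP a 0) => [a0|a0|->].
- by rewrite -oppr_gt0 -sinN -mulrN pos //; lra.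
- by apply/negbTE; rewrite -leNgt ltW // pos // a0.
- by rewrite mulr0 sin0 ltxx.
Qed.

Lemma sin_pi_neq0 a : -1 < a < 1 -> a != 0 -> sin (pi * a) != 0.
Proof.
move=> a1 a0; rewrite neq_lt sin_pi_lt0 // -oppr_lt0 -sinN -mulrN sin_pi_lt0; last by lra.
by rewrite oppr_lt0 -neq_lt.
Qed.

Lemma sin_pi_eq0 a b : 0 <= a <= 1 -> 0 <= b <= 1 -> a != b ->
  sin (pi * (b - a)) = 0 -> (a, b) = (0, 1) \/ (a, b) = (1, 0).
Proof.
move=> a01 b01 ab sab.
have far : ~ (-1 < b - a < 1).
  move=> d1; suff : sin (pi * (b - a)) != 0 by rewrite sab eqxx.
  by apply: sin_pi_neq0 => //; rewrite subr_eq0 eq_sym.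
have [ab1|ab1] := lerP (b - a) (-1); [right|left]; congr (_, _); lra.
Qed.

Lemma circle_point01 : circle_point 0 = circle_point 1 :> R[i].
Proof.
rewrite /circle_point mulr0 mulr1 (_ : 2 * pi = pi *+ 2); last by rewrite mulr_natl.
by rewrite cos0 sin0 cos2pi sin2pi.
Qed.

Lemma circle_point_eq a b : 0 <= a <= 1 -> 0 <= b <= 1 -> a != b ->
  sin (pi * (b - a)) = 0 -> circle_point a = circle_point b.
Proof.
by move=> a01 b01 ab /(sin_pi_eq0 a01 b01 ab)[] [-> ->]; rewrite circle_point01.
Qed.

Lemma chord_left a b : chord a b (circle_point a).
Proof. by apply/chordP; exists 0; [lra|congr (_ +i* _)%C; rewrite /u /v; ring]. Qed.

Lemma chord_right a b : chord a b (circle_point b).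
Proof. by apply/chordP; exists 1; [lra|congr (_ +i* _)%C; rewrite /u /v; ring]. Qed.

(** If the two lines are not parallel, their common point has barycentric
coordinates on each chord which are quotients of values of [side], and the two
hypotheses place these coordinates in [0, 1]. If the lines are parallel, all
values of [side] vanish; as the four parameters are distinct, this happens only
when two of them are 0 and 1, and the chords share the corresponding point. *)
Lemma on_both_sides_chord_meet a b c e :
  0 <= a <= 1 -> 0 <= b <= 1 -> 0 <= c <= 1 -> 0 <= e <= 1 ->
  uniq [:: a; b; c; e] -> on_both_sides a b c e -> on_both_sides c e a b ->
  (chord a b `&` chord c e !=set0)%classic.
Proof.
move=> a01 b01 c01 e01 /=.
rewrite !inE !negb_or -!andbA => /and4P[ab ac ae /and4P[bc be ce _]].
rewrite /on_both_sides => hS hT.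
have share p q : circle_point p = circle_point q -> p \in [:: a; b] ->
    q \in [:: c; e] -> (chord a b `&` chord c e !=set0)%classic.
  move=> pq pab qce; exists (circle_point p); split.
    move: pab; rewrite !inE => /orP[]/eqP->; [exact: chord_left|exact: chord_right].
  rewrite pq.
  move: qce; rewrite !inE => /orP[]/eqP->; [exact: chord_left|exact: chord_right].
(* Both differences are cross products of the directions of the two chords. *)
have parallel : side c e a - side c e b = - (side a b c - side a b e).
  by rewrite !side_cross_product; ring.
have [D0|D0] := eqVneq (side a b c - side a b e) 0; last first.
  pose t := side c e a / (side c e a - side c e b).
  pose t' := side a b c / (side a b c - side a b e).
  have unit01 (p q : R) : p * q <= 0 -> p - q != 0 -> 0 <= p / (p - q) <= 1.
    move=> pq npq; have dd : 0 < (p - q) ^+ 2 by rewrite exprn_even_gt0.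
    have -> : p / (p - q) = p * (p - q) / (p - q) ^+ 2 by field.
    have p2 : 0 <= p * p by rewrite -expr2 sqr_ge0.
    have q2 : 0 <= q * q by rewrite -expr2 sqr_ge0.
    rewrite ler_pdivlMr // ler_pdivrMr // mul0r mul1r.
    by move: pq p2 q2; rewrite expr2 !mulrBl !mulrBr (mulrC q p); clear; lra.
  exists (((1 - t) * u a + t * u b) +i* ((1 - t) * v a + t * v b))%C.
  split; apply/chordP; [exists t => //|exists t'].
  - by apply: unit01 => //; rewrite parallel oppr_eq0.
  - exact: unit01.
  - have tE : t = - (side c e a / (side a b c - side a b e)).
      by rewrite /t parallel invrN mulrN.
    congr (_ +i* _)%C; rewrite tE /t'; move: D0;
      rewrite !side_cross_product => D0; by field.
have S0 : side a b c = 0.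
  apply/eqP; rewrite -sqrf_eq0; apply/eqP/le_anti; rewrite sqr_ge0 andbT.
  by rewrite expr2; move: D0 => /eqP; rewrite subr_eq0 => /eqP {2}->.
have T0 : side c e a = 0.
  apply/eqP; rewrite -sqrf_eq0; apply/eqP/le_anti; rewrite sqr_ge0 andbT.
  move: parallel; rewrite D0 oppr0 => /eqP; rewrite subr_eq0 => /eqP.
  by rewrite expr2 => {2}->.
have four0 : (4 : R) != 0 by rewrite pnatr_eq0.
move/eqP: S0; rewrite /side !mulf_eq0 (negPf four0) /= => /orP[/orP[]|] /eqP s0.
- move/eqP: T0; rewrite /side !mulf_eq0 (negPf four0) /= => /orP[/orP[]|] /eqP t0.
  + (* Each chord is reduced to a point, so both have the ends 0 and 1. *)
    by case: (sin_pi_eq0 a01 b01 ab s0) (sin_pi_eq0 c01 e01 ce t0) ac ae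
      => -[-> _] [] [-> ->] /eqP ? /eqP ?.
  + apply: (share a c); rewrite ?inE ?eqxx ?orbT //.
    by apply/esym/circle_point_eq; rewrite // eq_sym.
  + apply: (share a e); rewrite ?inE ?eqxx ?orbT //.
    by apply/esym/circle_point_eq; rewrite // eq_sym.
- by apply: (share a c); rewrite ?inE ?eqxx ?orbT //; apply/circle_point_eq.
- by apply: (share b c); rewrite ?inE ?eqxx ?orbT //; apply/circle_point_eq.
Qed.

(** Unlike interlacing, this criterion remains valid when a parameter is 0 or 1,
where two distinct parameters give the same point of the circle. It expresses
crossing by inequalities between continuous functions. *)
Lemma crossing_sides x y :
  0 <= x.1 <= 1 -> 0 <= x.2 <= 1 -> 0 <= y.1 <= 1 -> 0 <= y.2 <= 1 ->
  crossing x y <-> [&& uniq [:: x.1; x.2; y.1; y.2],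
    on_both_sides x.1 x.2 y.1 y.2 & on_both_sides y.1 y.2 x.1 x.2].
Proof.
move=> x1 x2 y1 y2; split=> [[-> meet]|/and3P[xy h1 h2]].
  rewrite !chord_meet_on_both_sides //.
  by case: meet => z [? ?]; exists z; split.
by split=> //; exact: on_both_sides_chord_meet.
Qed.

(** All the angles that occur are between -pi and pi, so each sine has the sign of
the difference of the parameters; the factor depending on a and b only appears
squared. *)
Lemma on_both_sides_interlaced a b c e :
  0 < a < 1 -> 0 < b < 1 -> 0 < c < 1 -> 0 < e < 1 -> uniq [:: a; b; c; e] ->
  on_both_sides a b c e = interlaced a b c e.
Proof.
move=> a01 b01 c01 e01 /=.
rewrite !inE !negb_or -!andbA => /and4P[ab ac ae /and4P[bc be ce _]].
have sN0 (p q : R) : 0 < p < 1 -> 0 < q < 1 -> p != q -> sin (pi * (q - p)) != 0.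
  by move=> p01 q01 pq; apply: sin_pi_neq0; [lra|rewrite subr_eq0 eq_sym].
have sgrE (p q : R) : 0 < p < 1 -> 0 < q < 1 -> p != q ->
    Num.sg (sin (pi * (q - p))) = - (-1) ^+ (p < q)%R.
  move=> p01 q01 pq; rewrite -neqr0_sign ?sN0 // sin_pi_lt0; last by lra.
  by rewrite subr_lt0; case: (ltgtP p q) pq => //= _ _; rewrite ?expr1 ?expr0 ?opprK.
rewrite /on_both_sides -sgr_le0 /side !sgrM !(sgrE a, sgrE b) //.
rewrite (_ : Num.sg 4 = 1); last by rewrite gtr0_sg // ltr0n.
rewrite /interlaced; case: (a < b); case: (a < c); case: (a < e);
  case: (b < c); case: (b < e) => /=; rewrite ?expr1 ?expr0; lra.
Qed.

Lemma interlacedC a b c e : uniq [:: a; b; c; e] ->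
  interlaced c e a b = interlaced a b c e.
Proof.
rewrite /= !inE !negb_or -!andbA => /and4P[ab ac ae /and4P[bc be ce _]].
rewrite /interlaced; case: (ltgtP a c) ac => //; case: (ltgtP a e) ae => //.
all: by case: (ltgtP b c) bc => //; case: (ltgtP b e) be.
Qed.

End Geometry.

(** * Independent identically distributed families *)

Section Iid.
Local Open Scope classical_set_scope.
Local Open Scope ring_scope.

Lemma measurable_bool_set d (T : measurableType d) (f : T -> bool) :
  measurable_fun setT f -> measurable [set x | f x].
Proof.
move=> mf; have := mf measurableT [set true] I.
by rewrite setTI (_ : _ @^-1` _ = [set x | f x]) //; apply/seteqP; split.
Qed.

Section IndependentFamilies.
Context dT (T : measurableType dT) (R : realType) (I : finType).
Variable mu : probability T R.

(** Independence is expressed on products of measurable sets; by the pi-lambda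
theorem this determines the joint law ([iid_law_unique]). *)
Definition iid d (Omega : measurableType d) (P : probability Omega R)
    (Z : I -> Omega -> T) : Prop :=
  (forall i, measurable_fun setT (Z i)) /\
  forall A : I -> set T, (forall i, measurable (A i)) ->
    P [set w | forall i, A i (Z i w)] = (\prod_i mu (A i))%E.

Lemma iid_reindex d (Omega : measurableType d) (P : probability Omega R) Z
  (p : {perm I}) : iid P Z -> iid P (fun i => Z (p i)).
Proof.
move=> [mZ box]; split=> [i|A mA]; first exact: mZ.
rewrite (reindex_inj (@perm_inj _ p^-1%g)) /= -box; last by move=> i; exact: mA.
congr (P _); apply/seteqP; split=> w /= h i.
  by rewrite -[i in Z i](permKV p); exact: h.
by rewrite -[i in A i](permK p); exact: h.
Qed.

(** A pi-system of subsets of [I -> T], which generates the product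
sigma-algebra. *)
Definition boxes : set (set (I -> T)) :=
  [set B | exists2 A : I -> set T,
    (forall i, measurable (A i)) & B = [set z | forall i, A i (z i)]].

Definition box_space := g_sigma_algebraType boxes.

Lemma setI_closed_boxes : setI_closed boxes.
Proof.
move=> _ _ [A mA ->] [B mB ->]; exists (fun i => A i `&` B i).
  by move=> i; exact: measurableI.
by apply/seteqP; split=> z /=; [move=> [? ?] i; split|move=> h; split=> i; case: (h i)].
Qed.

Lemma boxesT : boxes setT.
Proof. by exists (fun=> setT) => //; apply/seteqP; split. Qed.

Lemma measurable_coord i : measurable_fun setT (fun z : box_space => z i).
Proof.
move=> _ B mB; rewrite setTI; apply: sub_sigma_algebra.
exists (fun j => if j == i then B else setT) => [j|]; first by case: ifP.
apply/seteqP; split=> z /= => [Bz j|/(_ i)]; last by rewrite eqxx.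
by case: eqP => [->|].
Qed.

Lemma measurable_joint d (Omega : measurableType d)
  (Z : I -> Omega -> T) : (forall i, measurable_fun setT (Z i)) ->
  measurable_fun setT (fun w => (fun i => Z i w) : box_space).
Proof.
move=> mZ; apply: (@measurability _ _ Omega box_space _ _ boxes) => // _ [_ [A mA ->] <-].
rewrite (_ : _ `&` _ = \bigcap_(i in [set: I]) (Z i @^-1` A i)).
  apply: fin_bigcap_measurable => // i _; rewrite -[X in measurable X]setTI.
  exact: mZ.
by apply/seteqP; split=> w /=; [move=> [_ h] i _; exact: h|move=> h; split=> // i; exact: h].
Qed.

(** The two laws agree on the pi-system of boxes, hence on the sigma-algebra
that it generates. *)
Lemma iid_law_unique d (Omega : measurableType d) (P : probability Omega R) Z
    d' (Omega' : measurableType d') (P' : probability Omega' R) Z' :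
  iid P Z -> iid P' Z' -> forall B : set box_space, measurable B ->
  P [set w | B (fun i => Z i w)] = P' [set w | B (fun i => Z' i w)].
Proof.
move=> [mZ box] [mZ' box'] B mB.
have mJ := measurable_joint mZ; have mJ' := measurable_joint mZ'.
pose X : {mfun Omega >-> box_space} := HB.pack (fun w => (fun i => Z i w) : box_space)
  (isMeasurableFun.Build _ _ _ _ _ mJ).
pose X' : {mfun Omega' >-> box_space} := HB.pack (fun w => (fun i => Z' i w) : box_space)
  (isMeasurableFun.Build _ _ _ _ _ mJ').
apply: (@measure_unique _ _ box_space boxes (fun=> setT) _ _ _ _
  (distribution P X) (distribution P' X')) => //.
- exact: setI_closed_boxes.
- by move=> _; exact: boxesT.
- by rewrite bigcup_const.
- move=> _ [A mA ->]; rewrite /distribution /pushforward.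
  by have := box A mA; have := box' A mA; move=> <-.
- by move=> _; rewrite (le_lt_trans (probability_le1 _ _)) // ltry.
Qed.

Lemma iid_exchangeable d (Omega : measurableType d) (P : probability Omega R) Z
    (p : {perm I}) (B : set box_space) : iid P Z -> measurable B ->
  P [set w | B (fun i => Z (p i) w)] = P [set w | B (fun i => Z i w)].
Proof. by move=> iidZ; apply: iid_law_unique => //; exact: iid_reindex. Qed.

End IndependentFamilies.

Section NoTies.
Context (R : realType) (I : finType) (mu : probability (measurableTypeR R) R).
Context d (Omega : measurableType d) (P : probability Omega R)
  (Z : I -> Omega -> measurableTypeR R).
Hypotheses (iidZ : iid mu P Z) (mu_atomless : forall x, mu [set x] = 0).

Lemma iid_pair i j (A B : set (measurableTypeR R)) : i != j ->
  measurable A -> measurable B ->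
  P [set w | A (Z i w) /\ B (Z j w)] = (mu A * mu B)%E.
Proof.
move=> ij mA mB; have [_ box] := iidZ.
have := box (fun l => if l == i then A else if l == j then B else setT).
rewrite (bigD1 i) //= (bigD1 j) 1?eq_sym //= eqxx (eq_sym j i) (negPf ij) eqxx.
rewrite big1 ?mule1 => [<-|l /andP[li lj]]; last 2 first.
- by move=> l; case: ifP => // _; case: ifP.
- by rewrite (negPf li) (negPf lj) probability_setT.
congr (P _); apply/seteqP; split=> w /= => [[Ai Bj] l|h].
  by case: eqP => [->|] //; case: eqP => [->|].
split; first by have := h i; rewrite eqxx.
by have := h j; rewrite eq_sym (negPf ij) eqxx.
Qed.

(** The joint law of two members of the family is the product of [mu] with
itself, and the sections of the diagonal are points, which have measure 0. *)
Lemma iid_tie_null i j : i != j -> P [set w | Z i w = Z j w] = 0.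
Proof.
move=> ij; have [mZ _] := iidZ.
have mJ := measurable_fun_pair (mZ i) (mZ j).
pose X : {mfun Omega >-> (measurableTypeR R * measurableTypeR R)%type} :=
  HB.pack (fun w => (Z i w, Z j w)) (isMeasurableFun.Build _ _ _ _ _ mJ).
pose D := [set x : measurableTypeR R * measurableTypeR R | x.1 = x.2].
have DE : D = [set x | x.1 == x.2] by apply/seteqP; split=> x /= /eqP.
have mD : measurable D.
  rewrite DE; apply: measurable_bool_set; apply: measurable_fun_eqr.
    exact: measurable_fst.
  exact: measurable_snd.
transitivity (distribution P X D); first by [].
rewrite -(@product_measure_unique _ _ _ _ _ mu mu) //.
  rewrite /product_measure1 integral0_eq // => x _.
  rewrite /= (_ : xsection D x = [set x]) ?mu_atomless //.
  by apply/seteqP; split=> y; rewrite /xsection /D /= inE /= => /esym.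
by move=> A B mA mB; rewrite -(iid_pair ij).
Qed.
End NoTies.
End Iid.

(** * Probability that a fixed matching of random points is crossing *)

Section FixedMatching.
Local Open Scope classical_set_scope.
Local Open Scope ring_scope.

Lemma measurable_forall_fin d (T : measurableType d) (I : finType)
  (F : I -> set T) : (forall i, measurable (F i)) ->
  measurable [set x | forall i, F i x].
Proof.
move=> mF; rewrite (_ : [set x | _] = \bigcap_(i in [set: I]) F i).
  exact: fin_bigcap_measurable.
by apply/seteqP; split=> x /= h i; [move=> _; exact: h|exact: h].
Qed.

Lemma probability_setI1 d (T : measurableType d) (R : realType)
    (P : probability T R) (A B : set T) :
  measurable A -> measurable B -> P B = 1%E -> P (A `&` B) = P A.
Proof.
move=> mA mB PB.
have PBC : P (~` B) = 0%E by rewrite probability_setC // PB subee.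
have mBC : measurable (~` B) by exact: measurableC.
rewrite [RHS](measureDI P mA mB) setDE; apply/esym.
by rewrite (subset_measure0 _ _ _ PBC) ?add0e //; exact: measurableI.
Qed.

Lemma probability_forall_fin d (T : measurableType d) (R : realType)
    (P : probability T R) (I : finType) (F : I -> set T) :
  (forall i, measurable (F i)) -> (forall i, P (F i) = 1%E) ->
  P [set x | forall i, F i x] = 1%E.
Proof.
move=> mF PF.
suff /(_ (enum I)) [_ <-] : forall l : seq I,
    measurable [set x | forall i, i \in l -> F i x] /\
    P [set x | forall i, i \in l -> F i x] = 1%E.
  congr (P _); apply/seteqP; split=> x /= h i; last by apply: h; rewrite mem_enum.
  by move=> _; exact: h.
elim=> [|i l [ml Pl]].
  rewrite (_ : mkset _ = setT); first by rewrite probability_setT.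
  by apply/seteqP; split.
rewrite (_ : mkset _ = F i `&` [set x | forall i, i \in l -> F i x]).
  by rewrite probability_setI1 //; split=> //; exact: measurableI.
apply/seteqP; split=> x /=.
  move=> h; split=> [|j jl]; apply: h; first by rewrite mem_head.
  by rewrite in_cons jl orbT.
by move=> [Fi h] j; rewrite in_cons => /orP[/eqP ->|/h].
Qed.

Lemma measure_disjoint_fin d (T : measurableType d) (R : realType)
    (P : {measure set T -> \bar R}) (I : finType) (A : {set I}) (F : I -> set T) :
  (forall i, measurable (F i)) ->
  (forall i j x, i \in A -> j \in A -> F i x -> F j x -> i = j) ->
  P [set x | exists2 i, i \in A & F i x] = (\sum_(i in A) P (F i))%E.
Proof.
move=> mF disj.
suff main l : uniq l -> {subset l <= A} ->
    measurable [set x | exists2 i, i \in l & F i x] /\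
    P [set x | exists2 i, i \in l & F i x] = (\sum_(i <- l) P (F i))%E.
  have [] := main (enum A); first exact: enum_uniq.
    by move=> i; rewrite mem_enum.
  rewrite big_enum => _ <-; congr (P _).
  by apply/seteqP; split=> x [i iA Fi]; exists i; rewrite // mem_enum in iA *.
elim: l => [_ _|i l IH /= /andP[il ul] lA].
  rewrite big_nil (_ : mkset _ = set0) ?measure0 //.
  by apply/seteqP; split=> // x [].
have [|ml Pl] := IH ul; first by move=> j jl; apply: lA; rewrite in_cons jl orbT.
rewrite big_cons (_ : mkset _ = F i `|` [set x | exists2 i, i \in l & F i x]).
  split; first exact: measurableU.
  rewrite measureU //; first by rewrite -Pl.
  apply/seteqP; split=> // x [Fi [j jl Fj]].
  have ij : i = j.
    by apply: (disj i j x) => //; apply: lA; rewrite ?mem_head // in_cons jl orbT.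
  by rewrite ij jl in il.
apply/seteqP; split=> x /=.
  by move=> [j]; rewrite in_cons => /orP[/eqP ->|]; [left|right; exists j].
by move=> [Fi|[j jl Fj]]; [exists i; rewrite ?mem_head|exists j; rewrite // in_cons jl orbT].
Qed.

Section CrossingMatchings.
Context (R : realType) (I : finType) (mu : probability (measurableTypeR R) R).
Context d (Omega : measurableType d) (P : probability Omega R)
  (Z : I -> Omega -> measurableTypeR R).
Hypotheses (iidZ : iid mu P Z) (mu_atomless : forall x, mu [set x] = 0%E).

Lemma measurable_crossing_matching s :
  measurable [set z : box_space (measurableTypeR R) I | crossing_matching z s].
Proof.
have mlt i j : measurable_fun setT (fun z : box_space (measurableTypeR R) I => (z i < z j)%R).
  by apply: measurable_fun_ltr; exact: measurable_coord.
have maddb (f g : box_space (measurableTypeR R) I -> bool) : measurable_fun setT f ->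
    measurable_fun setT g -> measurable_fun setT (fun z => f z (+) g z).
  move=> mf mg; rewrite (_ : (fun z => _) =
    (fun z => (f z && ~~ g z) || (~~ f z && g z))).
    by apply: measurable_or; apply: measurable_and => //; exact: measurable_neg.
  by apply/funext => z; case: (f z); case: (g z).
rewrite (_ : mkset _ = [set z | forall i j, (j != i) && (j != s i) ->
   interlaced (z i) (z (s i)) (z j) (z (s j))]); last first.
  apply/seteqP; split=> z /= h.
    by move=> i j; move/forallP/(_ i)/forallP/(_ j)/implyP : h.
  by apply/forallP => i; apply/forallP => j; apply/implyP; exact: h.
apply: (@measurable_forall_fin _ (box_space (measurableTypeR R) I)) => i.
apply: (@measurable_forall_fin _ (box_space (measurableTypeR R) I)) => j.
have [ij|ij] := boolP ((j != i) && (j != s i)); last first.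
  by rewrite [X in measurable X](_ : _ = setT) //; apply/seteqP; split.
rewrite [X in measurable X](_ : _ =
    [set z | interlaced (z i) (z (s i)) (z j) (z (s j))]); last first.
  by apply/seteqP; split=> z /=; [apply|].
apply: measurable_bool_set; apply: (maddb _ _ (maddb _ _ (maddb _ _ _ _) _) _); exact: mlt.
Qed.

(** Transporting a matching along a permutation of the indices is the same as
permuting the points. *)
Lemma crossing_matching_conj (s t p : {perm I}) (z : I -> R) :
  (forall i, p (s i) = t (p i)) ->
  crossing_matching (fun i => z (p i)) s = crossing_matching z t.
Proof.
move=> pst; apply/forallP/forallP => h i; apply/forallP => j.
  have /forallP/(_ ((p^-1)%g j)) := h ((p^-1)%g i).
  rewrite !pst !permKV (inj_eq perm_inj).
  by rewrite -[X in (_ && ~~ X)](inj_eq (@perm_inj _ p)) pst !permKV.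
have /forallP/(_ (p j)) := h (p i).
by rewrite -!pst !(inj_eq (@perm_inj _ p)).
Qed.

Lemma measurable_injective : measurable [set w | injective (fun i => Z i w)].
Proof.
have [mZ _] := iidZ.
rewrite (_ : mkset _ = [set w | forall i j, Z i w = Z j w -> i = j]) //.
apply: measurable_forall_fin => i; apply: measurable_forall_fin => j.
have [->|ij] := eqVneq i j.
  by rewrite [X in measurable X](_ : _ = setT) //; apply/seteqP; split.
rewrite [X in measurable X](_ : _ = ~` [set w | Z i w == Z j w]).
  by apply/measurableC/measurable_bool_set/measurable_fun_eqr; exact: mZ.
apply/seteqP; split=> w /=; first by move=> h /eqP/h/eqP; rewrite (negPf ij).
by move=> h e; case: h; apply/eqP.
Qed.

Lemma iid_injective : P [set w | injective (fun i => Z i w)] = 1%E.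
Proof.
have [mZ _] := iidZ.
pose F (ij : I * I) := [set w | ij.1 != ij.2 -> Z ij.1 w != Z ij.2 w].
have FE ij : F ij = if ij.1 == ij.2 then setT else ~` [set w | Z ij.1 w = Z ij.2 w].
  rewrite /F; case: ij => i j /=; case: eqVneq => // _; first by apply/seteqP; split.
  apply/seteqP; split=> w /=; first by move=> /(_ isT)/eqP.
  by move=> /eqP.
have mtie i j : measurable [set w | Z i w = Z j w].
  rewrite (_ : mkset _ = [set w | Z i w == Z j w]).
    by apply/measurable_bool_set/measurable_fun_eqr; exact: mZ.
  by apply/seteqP; split=> w /= /eqP.
rewrite (_ : mkset _ = [set w | forall ij, F ij w]).
  apply: probability_forall_fin => ij; rewrite FE; case: eqVneq => // nij.
  - exact: measurableC.
  - exact: probability_setT.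
  - by rewrite probability_setC // (iid_tie_null iidZ) ?sube0.
apply/seteqP; split=> w /=.
  by move=> h [i j]; rewrite /F /=; apply: contra_neq => /h.
move=> h i j e; apply/eqP; apply: contraT => ij.
by have := h (i, j) ij; rewrite /= e eqxx.
Qed.

(** The events attached to the different matchings have the same probability by
exchangeability, and almost surely exactly one of them occurs. *)
Lemma prob_crossing_matching k s :
  #|I| = k.*2 -> s \in perfect_matchings [set: I]%SET ->
  P [set w | crossing_matching (fun i => Z i w) s] = ((num_matchings k)%:R^-1)%:E.
Proof.
move=> cI sM; have [mZ _] := iidZ.
pose C t := [set w | crossing_matching (fun i => Z i w) t].
pose J := [set w | injective (fun i => Z i w)].
have mC t : measurable (C t).
  have := measurable_joint mZ measurableT (measurable_crossing_matching t).
  by rewrite setTI.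
have PC t : t \in perfect_matchings [set: I]%SET -> P (C t) = P (C s).
  move=> tM; have [p pst] := perfect_matchings_conj cI sM tM.
  rewrite -[RHS](iid_exchangeable p iidZ (measurable_crossing_matching s)).
  congr (P _); apply/seteqP; split=> w /=;
    by rewrite (crossing_matching_conj (fun i => Z i w) pst).
have sum1 : (\sum_(t in perfect_matchings [set: I]%SET) P (C t) = 1)%E.
  rewrite (eq_bigr (fun t => P (C t `&` J))); last first.
    by move=> t _; rewrite probability_setI1 //;
      [exact: measurable_injective|exact: iid_injective].
  rewrite -measure_disjoint_fin; first last.
  - move=> t u w tM uM [Ct wJ] [Cu _].
    have [t0 t0P] := exists_unique_crossing_matching wJ cI.
    have /eqP -> : t == t0 by rewrite -t0P tM.
    by apply/esym/eqP; rewrite -t0P uM.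
  - by move=> t; apply: measurableI => //; exact: measurable_injective.
  rewrite -iid_injective; congr (P _); apply/seteqP; split=> w /=.
    by move=> [t _ []].
  move=> wJ; have [t0 t0P] := exists_unique_crossing_matching wJ cI.
  by have /andP[] : _ && _ := etrans (t0P t0) (eqxx t0); exists t0.
have PCfin : P (C s) \is a fin_num by exact: fin_num_measure.
move: sum1; rewrite (eq_bigr _ PC) -/(C s) -(fineK PCfin) sumEFin sumr_const.
rewrite (card_perfect_matchings_setT cI) => -[e].
have m0 : (num_matchings k)%:R != 0 :> R.
  apply/eqP => e0; move: e; rewrite -mulr_natr e0 mulr0.
  by move=> /esym/eqP; rewrite oner_eq0.
by congr (_%:E); apply: (mulIf m0); rewrite mulVf // mulr_natr.
Qed.
End CrossingMatchings.
End FixedMatching.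

(** * Cliques in the circle graphon *)

Section CircleGraphon.
Local Open Scope classical_set_scope.
Local Open Scope ring_scope.

Lemma iid_iid_prob d (T : measurableType d) (R : realType)
    (P : probability T R) n :
  iid P (iid_prob P n) (fun (i : 'I_n) t => tnth t i).
Proof.
split=> [i|]; first exact: measurable_tnth.
elim: n => [|n IH] A mA.
  rewrite big_ord0 (_ : mkset _ = setT) ?probability_setT //.
  by apply/seteqP; split=> // t _ [].
rewrite big_ord_recl -(IH (fun i => A (lift ord0 i))) //.
rewrite -product_measure1E //; last first.
  apply: measurable_forall_fin => i; rewrite -[X in measurable X]setTI.
  exact: measurable_tnth.
rewrite /= /distribution /pushforward; congr (product_measure1 _ _ _).
apply/seteqP; split=> -[x t] /=.
  move=> h; split=> [|i]; first by have := h ord0; rewrite tnth0.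
  by have := h (lift ord0 i); rewrite tnthS.
move=> [Ax At] i; case: (unliftP ord0 i) => [j ->|->]; first by rewrite tnthS.
by rewrite tnth0.
Qed.

Section CrossingRule.
Variable R : realType.

(** The criterion of [crossing_sides], as a boolean that is measurable on the
whole plane; it coincides with [crossing] on the unit square only. *)
Definition crossing_rule (x y : R * R) : bool :=
  [&& uniq [:: x.1; x.2; y.1; y.2],
    on_both_sides x.1 x.2 y.1 y.2 & on_both_sides y.1 y.2 x.1 x.2].

Lemma measurable_crossing_rule d (T : measurableType d)
    (a b c e : T -> measurableTypeR R) :
  measurable_fun setT a -> measurable_fun setT b ->
  measurable_fun setT c -> measurable_fun setT e ->
  measurable_fun setT (fun x => crossing_rule (a x, b x) (c x, e x)).
Proof.
move=> ma mb mc me.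
have mneq (f g : T -> measurableTypeR R) : measurable_fun setT f ->
    measurable_fun setT g -> measurable_fun setT (fun x => f x != g x).
  by move=> mf mg; apply: measurable_neg; exact: measurable_fun_eqr.
have msin (f g : T -> measurableTypeR R) : measurable_fun setT f ->
    measurable_fun setT g -> measurable_fun setT (fun x => sin (pi * (g x - f x))).
  move=> mf mg; apply: (measurableT_comp (continuous_measurable_fun (@continuous_sin R))).
  apply: measurable_funM => //; exact: measurable_funB.
have mside (f g h : T -> measurableTypeR R) : measurable_fun setT f ->
    measurable_fun setT g -> measurable_fun setT h ->
    measurable_fun setT (fun x => side (f x) (g x) (h x)).
  move=> mf mg mh; rewrite /side.
  by do !apply: measurable_funM => //; exact: msin.
have mboth (f g h l : T -> measurableTypeR R) : measurable_fun setT f ->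
    measurable_fun setT g -> measurable_fun setT h -> measurable_fun setT l ->
    measurable_fun setT (fun x => on_both_sides (f x) (g x) (h x) (l x)).
  move=> mf mg mh ml; apply: measurable_fun_ler => //.
  by apply: measurable_funM; exact: mside.
apply: measurable_and; last by apply: measurable_and; exact: mboth.
rewrite (_ : (fun x => _) = (fun x => ((a x != b x) && (a x != c x) && (a x != e x)) &&
  ((b x != c x) && (b x != e x)) && (c x != e x))).
  by do !apply: measurable_and; exact: mneq.
by apply/funext => x; rewrite /= !inE !negb_or -!andbA andbT.
Qed.
End CrossingRule.

Section CliqueDensity.
Variable R : realType.
Local Notation unif := (unif01 R).

Lemma unif01E (A : set (measurableTypeR R)) : measurable A ->
  unif A = lebesgue_measure (A `&` @unit_interval R).
Proof.
move=> mA; rewrite /unif01 /= /uniform_prob integral_uniform_pdf.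
have mAI : measurable (A `&` `[0%R, 1%R]) by exact: measurableI.
rewrite (eq_integral (fun=> 1%E)).
  by rewrite integral_cst // mul1e.
move=> x; rewrite inE => -[_]; rewrite /= in_itv /= => x01.
by rewrite /uniform_pdf x01 subr0 invr1.
Qed.

Lemma unif01_set1 x : unif [set x] = 0%E.
Proof.
rewrite unif01E //; apply: (subset_measure0 _ _ _ (lebesgue_measure_set1 x)) => //.
apply: measurableI => //; exact: measurable_itv.
Qed.

Lemma unif01_itv01 b c : unif [set` Interval (BSide b 0) (BSide c 1)] = 1%E.
Proof.
rewrite unif01E // setIidl.
  by rewrite lebesgue_measure_itv /= lte01 sube0.
move=> x; rewrite /unit_interval /= !in_itv /=.
by case: b; case: c; rewrite /= => /andP[h1 h2]; rewrite ?(ltW h1) ?(ltW h2) ?h1 ?h2.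
Qed.

Variable Psi : measurableTypeR R -> measurableTypeR R * measurableTypeR R.
Hypothesis hPsi : pushes_to_unit_square Psi.

(** [Psi] is only constrained on the unit interval. Outside of it the value is
set to (0, 0), which makes the map measurable on the whole line. *)
Definition chord_ends x := if 0 <= x <= 1 then Psi x else (0, 0).

Lemma measurable_chord_ends : measurable_fun setT chord_ends.
Proof.
have [_ mPsi _] := hPsi.
have mc : measurable_fun setT (fun x : measurableTypeR R => 0 <= x <= 1).
  by apply: measurable_and; apply: measurable_fun_ler.
apply: measurable_fun_if => //.
by rewrite setTI (_ : _ @^-1` _ = unit_interval (R := R)) //.
Qed.

Section Points.
Variable k : nat.

Definition endpoint (ib : 'I_k * bool) (X : k.-tuple (measurableTypeR R)) :
    measurableTypeR R :=
  (if ib.2 then snd else fst) (chord_ends (tnth X ib.1)).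

Lemma measurable_endpoint ib : measurable_fun setT (endpoint ib).
Proof.
rewrite /endpoint; case: ib => i [] /=;
  apply: measurableT_comp => //;
  apply: (measurableT_comp measurable_chord_ends); exact: measurable_tnth.
Qed.

(** That [Psi] pushes the Lebesgue measure of the interval to that of the square
makes the two ends of one chord independent and uniform. *)
Lemma iid_endpoint : iid unif (iid_prob unif k) endpoint.
Proof.
split=> [|A mA]; first exact: measurable_endpoint.
pose B i := chord_ends @^-1` (A (i, false) `*` A (i, true)).
have mAA i : measurable (A (i, false) `*` A (i, true)) by exact: measurableX.
have mB i : measurable (B i).
  by rewrite -[X in measurable X]setTI; exact: measurable_chord_ends.
have [_ box] := iid_iid_prob unif k.
rewrite (_ : mkset _ = [set X | forall i, B i (tnth X i)]).
  rewrite box //.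
  rewrite [RHS](eq_bigr (fun ib => unif (A (ib.1, ib.2)))); last by case.
  rewrite -(pair_bigA _ (fun i b => unif (A (i, b)))) /=.
  apply: eq_bigr => i _; rewrite big_bool /=.
  have [h01 _ push] := hPsi.
  transitivity ((lebesgue_measure \x lebesgue_measure)%E
    ((A (i, false) `&` @unit_interval R) `*` (A (i, true) `&` @unit_interval R))).
    rewrite setXI -push // unif01E; last exact: mB.
    congr (lebesgue_measure _).
    apply/seteqP; split=> x; rewrite /B /chord_ends /unit_interval /= !in_itv /=.
      by move=> [] + x01; rewrite x01.
    by move=> [x01]; rewrite x01.
  rewrite product_measure1E; try by apply: measurableI => //; exact: measurable_itv.
  by rewrite !unif01E // muleC.
apply/seteqP; split=> X /= h.
  by move=> i; split; [exact: (h (i, false))|exact: (h (i, true))].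
by move=> [i []]; have [] := h i.
Qed.

Definition in_unit (X : k.-tuple (measurableTypeR R)) :=
  forall i, tnth X i \in `[0, 1]%R.

Definition endpoints i X := (endpoint (i, false) X, endpoint (i, true) X).

Lemma endpointsE X i : in_unit X -> endpoints i X = Psi (tnth X i).
Proof.
move=> /(_ i); rewrite in_itv /= /endpoints /endpoint /chord_ends /= => ->.
by case: (Psi _).
Qed.

Lemma measurable_in_unit : measurable [set X | in_unit X].
Proof.
apply: measurable_forall_fin => i.
have := @measurable_tnth _ (measurableTypeR R) _ i measurableT _
  (measurable_itv `[0%R, 1%R]).
by rewrite setTI.
Qed.

Lemma prob_in_unit : iid_prob unif k [set X | in_unit X] = 1%E.
Proof.
have [_ box] := iid_iid_prob unif k.
have := box (fun=> `[0%R, 1%R]%classic).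
by rewrite big1 => [|i _]; [exact|exact: unif01_itv01].
Qed.

Lemma crossing_endpoints X i j : in_unit X ->
  crossing (endpoints i X) (endpoints j X) <->
  crossing_rule (endpoints i X) (endpoints j X).
Proof.
move=> X01; have [h _ _] := hPsi; rewrite !endpointsE //.
have [] := h _ (X01 i); have [] := h _ (X01 j); rewrite !in_itv /= => *.
exact: crossing_sides.
Qed.

Lemma measurable_crossing_endpoints i j :
  measurable_fun setT (fun X => crossing_rule (endpoints i X) (endpoints j X)).
Proof. by apply: measurable_crossing_rule; exact: measurable_endpoint. Qed.

Definition all_cross (X : k.-tuple (measurableTypeR R)) := forall i j : 'I_k,
  (i < j)%N -> crossing_rule (endpoints i X) (endpoints j X).

Lemma measurable_all_cross : measurable [set X | all_cross X].
Proof.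
apply: measurable_forall_fin => i; apply: measurable_forall_fin => j.
case: (ltnP i j) => ij; last first.
  by rewrite [X in measurable X](_ : _ = setT) //; apply/seteqP; split.
rewrite [X in measurable X](_ : _ =
  [set X | crossing_rule (endpoints i X) (endpoints j X)]).
  by apply: measurable_bool_set; exact: measurable_crossing_endpoints.
by apply/seteqP; split=> X /=; [apply|].
Qed.

Definition other_end (ib : 'I_k * bool) := (ib.1, ~~ ib.2).

Lemma other_endK : involutive other_end.
Proof. by move=> [i b]; rewrite /other_end /= negbK. Qed.

Definition other_end_matching := perm (inv_inj other_endK).

Lemma other_end_matching_perfect : other_end_matching \in perfect_matchings [set: 'I_k * bool]%SET.
Proof.
apply/perfect_matchingsP; split=> x; rewrite !permE ?other_endK //.
by case: x => i b; rewrite inE /other_end xpair_eqE eqxx; case: b.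
Qed.

(** In [crossing_matching] each pair of chords is tested for each choice of an end
in both of them; by the symmetries of [interlaced] these tests agree. *)
Lemma all_cross_matching X : injective (fun ib => endpoint ib X) ->
  (forall ib, 0 < endpoint ib X < 1) ->
  all_cross X <-> crossing_matching (fun ib => endpoint ib X) other_end_matching.
Proof.
move=> X_inj X01.
have uniq4 i j : i != j ->
    uniq [:: endpoint (i, false) X; endpoint (i, true) X;
             endpoint (j, false) X; endpoint (j, true) X].
  by move=> ij; rewrite /= !inE !(inj_eq X_inj) !xpair_eqE (negPf ij) !andbF.
have ruleE i j : i != j -> crossing_rule (endpoints i X) (endpoints j X) =
    interlaced (endpoint (i, false) X) (endpoint (i, true) X)
               (endpoint (j, false) X) (endpoint (j, true) X).
  move=> ij; have ji : j != i by rewrite eq_sym.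
  rewrite /crossing_rule /endpoints uniq4 //= !on_both_sides_interlaced ?uniq4 //.
  by rewrite interlacedC ?uniq4 // andbb.
split=> [cross|/forallP cm i j ij].
  apply/forallP => -[i b]; apply/forallP => -[j c]; apply/implyP.
  rewrite !permE /other_end /= !xpair_eqE => h.
  have ji : j != i by move: h; case: eqP => //=; case: b; case: c.
  have : interlaced (endpoint (i, false) X) (endpoint (i, true) X)
               (endpoint (j, false) X) (endpoint (j, true) X).
    have [ij|ij] := ltnP i j; first by rewrite -ruleE 1?eq_sym //; exact: cross.
    have := cross j i; rewrite ltn_neqAle ij andbT => /(_ ji).
    by rewrite ruleE // interlacedC // uniq4 // eq_sym.
  by rewrite /interlaced; case: b {h}; case: c; do 4!case: (_ < _).
have nij : i != j by rewrite -val_eqE /= ltn_eqF.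
rewrite ruleE //; have /forallP/(_ (j, false)) := cm (i, false).
by rewrite !permE /other_end /= !xpair_eqE eq_sym (negPf nij).
Qed.

Lemma prob_all_cross :
  iid_prob unif k [set X | all_cross X] = ((num_matchings k)%:R^-1)%:E.
Proof.
have [mZ box] := iid_endpoint.
pose J := [set X : k.-tuple (measurableTypeR R) | injective (fun ib => endpoint ib X)].
pose O := [set X : k.-tuple (measurableTypeR R) |
  forall ib, `]0%R, 1%R[%classic (endpoint ib X)].
have mJ : measurable J by exact: measurable_injective iid_endpoint.
have mO : measurable O.
  apply: measurable_forall_fin => ib.
  have := measurable_endpoint ib measurableT (measurable_itv `]0%R, 1%R[).
  by rewrite setTI.
have PJ : iid_prob unif k J = 1%E by exact: iid_injective iid_endpoint unif01_set1.
have PO : iid_prob unif k O = 1%E.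
  have := box (fun=> `]0%R, 1%R[%classic).
  by rewrite big1 => [|ib _]; [exact|exact: unif01_itv01].
have cI : #|{: 'I_k * bool}| = k.*2 by rewrite card_prod card_ord card_bool muln2.
rewrite -(prob_crossing_matching iid_endpoint unif01_set1 cI other_end_matching_perfect).
have mC : measurable [set X | crossing_matching (fun ib => endpoint ib X) other_end_matching].
  have := measurable_joint mZ measurableT (@measurable_crossing_matching R _ other_end_matching).
  by rewrite setTI.
rewrite -(probability_setI1 measurable_all_cross mJ PJ).
rewrite -(probability_setI1 (measurableI _ _ measurable_all_cross mJ) mO PO).
rewrite -(probability_setI1 mC mJ PJ).
rewrite -(probability_setI1 (measurableI _ _ mC mJ) mO PO).
congr (iid_prob _ _ _); apply/seteqP.
by split=> X /= [[cX XJ] XO]; split=> //; split=> //;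
  apply/(all_cross_matching XJ) => // ib; have := XO ib; rewrite /= in_itv.
Qed.

(** Every relabelling of a clique is the same clique, so the isomorphism carries
no information. *)
Lemma isomorphic_clique (e : rel 'I_k) :
  isomorphic (upper_graph e) (clique k) <-> forall i j : 'I_k, (i < j)%N -> e i j.
Proof.
split=> [[s iso] i j ij|h].
  have := iso i j; rewrite /= (inj_eq perm_inj) /upper_edge ij ltnNge (ltnW ij) /=.
  by rewrite orbF => <-; rewrite -val_eqE /= neq_ltn ij.
exists 1%g => i j; rewrite !perm1 /= /upper_edge -val_eqE /= neq_ltn.
by case: (ltngtP i j) => //= ij; rewrite h.
Qed.

Let thresholds := k.-tuple (k.-tuple (measurableTypeR R)).

(** The auxiliary variables that decide about the edges are almost surely in
[0, 1[. They are then below 1 and not below 0, so that a graphon with values 0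
and 1 determines the sampled graph. *)
Definition thresholds_in_unit : set thresholds :=
  [set U | forall i j, `[0%R, 1%R[%classic (tnth (tnth U i) j)].

Lemma measurable_tnth2 i j :
  measurable_fun setT (fun U : thresholds => tnth (tnth U i) j).
Proof.
apply: (measurableT_comp (measurable_tnth (T := measurableTypeR R) j)).
exact: measurable_tnth.
Qed.

Lemma measurable_thresholds_in_unit : measurable thresholds_in_unit.
Proof.
apply: measurable_forall_fin => i; apply: measurable_forall_fin => j.
have := measurable_tnth2 i j measurableT (measurable_itv `[0%R, 1%R[).
by rewrite setTI.
Qed.

Lemma prob_thresholds_in_unit : iid_prob (iid_prob unif k) k thresholds_in_unit = 1%E.
Proof.
have [_ box] := iid_iid_prob unif k.
have [_ box2] := iid_iid_prob (iid_prob unif k) k.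
have := box2 (fun=> [set V | forall j, `[0%R, 1%R[%classic (tnth V j)]).
rewrite big1 => [|i _].
  apply; move=> i; apply: measurable_forall_fin => j.
  have := @measurable_tnth _ (measurableTypeR R) _ j measurableT _
    (measurable_itv `[0%R, 1%R[).
  by rewrite setTI.
have := box (fun=> `[0%R, 1%R[%classic).
by rewrite big1 => [|j _]; [exact|exact: unif01_itv01].
Qed.

(** Expressing the edges by [crossing_rule] makes this event measurable; it is
the one whose probability defines the density ([sample_clique]). *)
Definition clique_event : set (k.-tuple (measurableTypeR R) * thresholds) :=
  [set xu | in_unit xu.1 /\ forall i j : 'I_k, (i < j)%N ->
    tnth (tnth xu.2 i) j < (crossing_rule (endpoints i xu.1) (endpoints j xu.1))%:R].

Lemma sample_clique xu : in_unit xu.1 ->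
  isomorphic (sample (circle_graphon Psi) xu) (clique k) <-> clique_event xu.
Proof.
move=> X01; rewrite /sample isomorphic_clique /clique_event /=.
have wE i j : circle_graphon Psi (tnth xu.1 i) (tnth xu.1 j) =
    (crossing_rule (endpoints i xu.1) (endpoints j xu.1))%:R.
  rewrite /circle_graphon -!endpointsE //; congr ((nat_of_bool _)%:R).
  apply/asboolP/idP; [move=> /crossing_endpoints; exact|].
  by move=> ?; apply/crossing_endpoints.
by split=> [h|[_ h] i j ij]; [split=> // i j ij; rewrite -wE h|rewrite wE h].
Qed.

Lemma measurable_clique_event : measurable clique_event.
Proof.
rewrite (_ : clique_event = ([set X | in_unit X] `*` setT) `&`
  [set xu | forall i j : 'I_k, (i < j)%N ->
    tnth (tnth xu.2 i) j < (crossing_rule (endpoints i xu.1) (endpoints j xu.1))%:R]).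
  apply: measurableI; first by apply: measurableX => //; exact: measurable_in_unit.
  apply: measurable_forall_fin => i; apply: measurable_forall_fin => j.
  case: (ltnP i j) => ij; last first.
    by rewrite [X in measurable X](_ : _ = setT) //; apply/seteqP; split.
  rewrite [X in measurable X](_ : _ = [set xu | tnth (tnth xu.2 i) j <
      (crossing_rule (endpoints i xu.1) (endpoints j xu.1))%:R]).
    apply: measurable_bool_set; apply: measurable_fun_ltr.
      exact: (measurableT_comp (measurable_tnth2 i j)).
    rewrite (_ : (fun xu => _) = (fun xu => if crossing_rule (endpoints i xu.1)
      (endpoints j xu.1) then 1 else 0)).
      apply: measurable_fun_ifT => //.
      exact: (measurableT_comp (measurable_crossing_endpoints i j)).
    by apply/funext => xu; case: crossing_rule.
  by apply/seteqP; split=> xu /=; [apply|].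
by apply/seteqP; split=> xu /=; [move=> []|move=> [[] ]].
Qed.

(** On the almost sure event that the auxiliary variables are in [0, 1[, the
clique event only depends on the chords, and it is the event that they cross
pairwise. *)
Lemma Dens_clique :
  Dens (clique k) (circle_graphon Psi) = ((num_matchings k)%:R^-1)%:E.
Proof.
have mG : measurable (setT `*` thresholds_in_unit : set (k.-tuple (measurableTypeR R) * thresholds)).
  by apply: measurableX => //; exact: measurable_thresholds_in_unit.
have PG : sample_prob R k (setT `*` thresholds_in_unit) = 1%E.
  rewrite /sample_prob /= product_measure1E //; last exact: measurable_thresholds_in_unit.
  rewrite -[RHS]mule1; congr (_ * _)%E; last exact: prob_thresholds_in_unit.
  exact: probability_setT.
rewrite /Dens (_ : mkset _ = clique_event); last first.
  apply/seteqP; split=> xu /=; first by move=> [X01 /sample_clique]; exact.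
  by move=> c; have [X01 _] := c; split=> //; apply/sample_clique.
rewrite -(probability_setI1 measurable_clique_event mG PG).
rewrite (_ : _ `&` _ = ([set X | in_unit X] `&` [set X | all_cross X]) `*` thresholds_in_unit).
  have m1 := measurable_in_unit; have m2 := measurable_all_cross.
  rewrite /sample_prob /= product_measure1E //; last 2 first.
  - exact: measurableI.
  - exact: measurable_thresholds_in_unit.
  rewrite setIC -[RHS]mule1; congr (_ * _)%E; last exact: prob_thresholds_in_unit.
  by rewrite -prob_all_cross; exact: probability_setI1 m2 m1 prob_in_unit.
apply/seteqP; split=> -[X U] /=.
  move=> [[X01 h] [_ U01]]; split=> //; split=> // i j ij.
  have := h i j ij; have := U01 i j; rewrite /= in_itv /= => /andP[U0 _].
  by case: crossing_rule => //; rewrite ltNge U0.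
move=> [[X01 h] U01]; split=> //; split=> // i j ij.
by have := U01 i j; rewrite /= in_itv /= (h i j ij) => /andP[].
Qed.
End Points.
End CliqueDensity.

Lemma num_matchings_inv (R : realType) k :
  ((num_matchings k)%:R^-1 : R) = (2 ^ k * k`!)%N%:R / ((2 * k)`!)%:R.
Proof.
have c0 : (2 ^ k * k`!)%N%:R != 0 :> R.
  by rewrite pnatr_eq0 -lt0n muln_gt0 expn_gt0 fact_gt0.
by rewrite -num_matchings_factorial [X in _ / X]natrM invfM mulrCA mulfV ?mulr1.
Qed.
End CircleGraphon.

Unset Implicit Arguments.
Theorem proposition5p15 (R : realType)
    (Psi : measurableTypeR R -> measurableTypeR R * measurableTypeR R)
    (hPsi : pushes_to_unit_square Psi) :
  (forall k : nat, (1 <= k)%N ->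
     Dens (clique k) (circle_graphon Psi) = ((num_matchings k)%:R^-1)%:E /\
     ((num_matchings k)%:R^-1 : R) = (2 ^ k * k`!)%N%:R / ((2 * k)`!)%:R) /\
  Dens (clique 2) (circle_graphon Psi) = (1 / 3)%:E /\
  Dens (clique 3) (circle_graphon Psi) = (1 / 15)%:E.
Proof.
split=> [k _|]; first by split; [exact: Dens_clique|exact: num_matchings_inv].
have value k n : (num_matchings k * (2 ^ k * k`!) = n * (2 ^ k * k`!))%N ->
    Dens (clique k) (circle_graphon Psi) = (1 / n%:R)%:E.
  move=> /eqP; rewrite eqn_pmul2r ?muln_gt0 ?expn_gt0 ?fact_gt0 // => /eqP <-.
  by rewrite div1r Dens_clique.
by split; apply: value; rewrite num_matchings_factorial.
Qed.
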